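(* Let $S$ be an unpunctured surface, let $Q$ be the quiver of its special triangulation, let $G=G(Q)$ be the group with generators $s_1,\dots,s_n$ associated with $Q$, and let $W=W({\bf u},Q)$ be the extended affine Weyl group generated by the reflections $r_1,\dots,r_n$, $r_i=r_{u_i}$, in the vectors of the special companion basis ${\bf u}=\{u_1,\dots,u_n\}$ of $Q$ (all defined in the context). Then the mapping of generators $s_i\mapsto r_i$ extends to a surjective homomorphism $\varphi: G\to W$.
   Context: **Surfaces and quivers.** An unpunctured surface is a compact connected oriented surface with at least one boundary component and finitely many marked points, all on the boundary, at least one on every boundary component, admitting a triangulation with at least one interior arc. A triangulation is by non-crossing arcs with endpoints at marked points. Its quiver has the interior arcs as vertices; each triangle contributes one arrow between every two of its sides that are arcs, the arrows inside a triangle directed counter-clockwise; opposite arrows cancel. Let $n$ be the number of arcs. ''Subquiver'' means full (induced) subquiver; $i\Rightarrow j$ denotes a double arrow. **Special triangulation.** Let $S$ have genus $g$ and boundary components $b_0,\dots,b_h$ ($h=b-1$), with $k_i\ge1$ marked points on $b_i$. Fix a marked point $p\in b_0$. Choose loops based at $p$, disjoint except at $p$: loops $z_1,\dots,z_g$, each $z_i$ cutting off a torus $H_i$ with one boundary component $z_i$ and single marked point $p$; and loops $y_1,\dots,y_h$, each $y_i$ cutting off an annulus $A_i$ with boundary components $y_i$ (marked point $p$) and $b_i$; such that the remaining piece $P$ is a disk, viewed as a polygon whose sides are, in cyclic order, the $k_0$ segments of $b_0$, then $z_1,\dots,z_g$, then $y_1,\dots,y_h$. (If $P$ is a bigon,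 i.e. $k_0=1$, $g+h=1$, the single loop is identified with the boundary segment and is not an arc.) - In $P$: let $x,z,y$ be the diagonals cutting off respectively the $k_0$ boundary segments, the sides $z_1,\dots,z_g$, the sides $y_1,\dots,y_h$ (if a group has one element, the corresponding diagonal is that side itself; if it is empty the diagonal is absent; parallel diagonals are identified). The polygon with sides $z,z_1,\dots,z_g$ is triangulated by the diagonals cutting off $\{z_j,\dots,z_g\}$, $1<j<g$; the polygon with sides $y,y_1,\dots,y_h$ by the diagonals cutting off $\{y_j,\dots,y_h\}$, $1<j<h$; the polygon with sides $x$ and the $k_0$ boundary segments (or $P$ itself if $g=h=0$) is triangulated so that no triangle in it has three sides that are arcs. - Each $H_i$ is triangulated by four arcs $\alpha_i,\beta_i,\gamma_i,\varepsilon_i$ with triangles having sides $\{\alpha_i,\gamma_i,\beta_i\}$, $\{\alpha_i,\gamma_i,\varepsilon_i\}$, $\{\beta_i,\varepsilon_i,z_i\}$, giving arrows $\alpha_i\Rightarrow\gamma_i$, $\gamma_i\to\beta_i\to\alpha_i$, $\gamma_i\to\varepsilon_i\to\alpha_i$, a simple arrow between $\beta_i$ and $\varepsilon_i$, and (if $z_i$ is an arc) an oriented 3-cycle on $\beta_i,\varepsilon_i,z_i$. - Each $A_i$ is triangulated by two arcs $a_i,c_i$ joining $p$ to one marked point $p_i\in b_i$, the loop $x_i$ at $p_i$ parallel to $b_i$ ($x_i$ is the boundary segment if $k_i=1$), with triangles $\{y_i,a_i,c_i\}$, $\{x_i,a_i,c_i\}$, and a triangulation of the polygon with sides $x_i$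 and the $k_i$ segments of $b_i$ in which no triangle has three sides that are arcs. Thus $a_i,c_i$ are joined by a double arrow. **Special companion basis.** Let $Q'$ be the subquiver of $Q$ obtained by deleting all $c_i$ ($1\le i\le h$) and all $\alpha_i,\gamma_i$ ($1\le i\le g$); it is of mutation type $A_m$, $m=n-2g-h$. Let $V_+$ be the positive definite space spanned by a root system of type $A_m$ (roots of square length 2) and assign to the vertices of $Q'$ roots forming a basis of $V_+$ whose Gram matrix $(a_{ij})$ satisfies $|a_{ij}|=$ number of arrows between $i$ and $j$ for $i\neq j$, $a_{ij}a_{jk}a_{ki}>0$ for every oriented 3-cycle $i,j,k$ of $Q'$, and $a_{ij}a_{jk}a_{ki}\le0$ for all other triples; signs are chosen so that the vectors at $\beta_i,\varepsilon_i$ have inner product $-1$. Let $V_0$ be a real vector space with basis $\delta_k$ ($1\le k\le h$), $\delta^1_i,\delta^2_i$ ($1\le i\le g$), and let $V=V_+\oplus V_0$ with the form $\langle\cdot,\cdot\rangle$ extended so that $V_0$ is its radical. Assign to $c_k$ the vector $v_{a_k}+\delta_k$, and to $\alpha_i,\gamma_i$ the vectors $v_{\beta_i}+v_{\varepsilon_i}+\delta_i^1$, $v_{\beta_i}+v_{\varepsilon_i}+\delta_i^2$, where $v_{\bullet}$ denotes the vector already assigned to the vertex $\bullet$. The resulting $n$ vectors form ${\bf u}=\{u_1,\dots,u_n\}$. **Group $W$.** Extend the form to $V\oplus V_0^*$, where $V_0^*$ has the basis dual to that of $V_0$, by $\langle V_+,V_0^*\rangle=0$, the natural pairing between $V_0$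 and $V_0^*$, and $\langle V_0^*,V_0^*\rangle=0$. $W=W({\bf u},Q)$ is the group generated by the reflections $r_i(w)=w-\langle w,u_i\rangle u_i$ on $V\oplus V_0^*$. **Group $G(Q)$.** Generators $s_1,\dots,s_n$ (one for each vertex of $Q$); relations: (R1) $s_i^2=e$; (R2) $(s_is_j)^2=e$ if $i,j$ are not joined, $(s_is_j)^3=e$ if they are joined by a single arrow (no relation for a double arrow); (R3) $(s_1s_2s_3s_2)^2=e$ for every subquiver that is an oriented 3-cycle on vertices $1,2,3$ with simple arrows; $(s_1s_2s_3s_2)^3=e$ for every subquiver that is an oriented 3-cycle with one double arrow, joining $1$ and $3$, and two simple arrows; (R4) $(s_1s_2s_3s_4s_3s_2)^2=e$ for every subquiver with arrows $1\Rightarrow3$, $3\to2\to1$, $3\to4\to1$ ($2,4$ not joined); (R5) $(s_1s_2s_3s_4s_3s_2)^3=e$ for every subquiver with arrows $1\Rightarrow3$, $3\to2\to1$, $3\to4\to1$ and a simple arrow between $2$ and $4$; and $(s_1s_2s_3s_4s_5s_4s_3s_2)^2=e$ for every subquiver consisting of such a quiver together with a vertex $5$ forming with $2,4$ an oriented 3-cycle with simple arrows and not joined to $1,3$. Here the labels $1,\dots,5$ run over all labellings of vertices of $Q$ by which the subquiver has the indicated form, possibly after reversing all arrows. *)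

(* Defs.v *)
From HB Require Import structures.
From mathcomp Require Import all_boot all_order all_algebra.
From mathcomp Require Import generic_quotient.
From mathcomp Require Import boolp reals.

Set Implicit Arguments.
Unset Strict Implicit.
Unset Printing Implicit Defensive.

Import Order.TTheory GRing.Theory Num.Theory.

Local Open Scope nat_scope.

(** ** Surfaces *)

(** An unpunctured surface is recorded, up to homeomorphism, by its genus, the
    number [h] of boundary components other than [b_0], and the number of
    marked points on each [b_0, ..., b_h].  A surface of this kind has a
    triangulation with an interior arc unless it is a disk with at most three
    marked points. *)
Record surface := Surface {
  genus : nat;
  holes : nat;
  marked : 'I_holes.+1 -> nat;
  marked_gt0 : forall i, 0 < marked i;
  has_interior_arc : (0 < genus) || (0 < holes) || (3 < marked ord0)
}.

Arguments marked : clear implicits.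

(** ** Triangulated polygons *)

(** The vertices of an [N]-gon are [0, ..., N.-1] in counter-clockwise order.
    A segment joining two of them is a pair [(i, j)] with [i < j]. *)
Definition edge (N a b : nat) : nat * nat :=
  (minn (a %% N) (b %% N), maxn (a %% N) (b %% N)).

Definition polygon_side (N : nat) (e : nat * nat) : bool :=
  (e.1 < e.2 < N) && ((e.2 == e.1.+1) || (e == (0, N.-1))).

Definition diagonal (N : nat) (e : nat * nat) : bool :=
  (e.1 < e.2 < N) && ~~ polygon_side N e.

Definition crossing (e f : nat * nat) : bool :=
  (e.1 < f.1 < e.2) && (e.2 < f.2) || (f.1 < e.1 < f.2) && (f.2 < e.2).

(** [D] lists the elements of a maximal set of pairwise non-crossing
    diagonals. *)
Definition polygon_triangulation (N : nat) (D : seq (nat * nat)) : Prop :=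
  [/\ {in D, forall e, diagonal N e},
      {in D &, forall e f, ~~ crossing e f}
    & forall d, diagonal N d -> {in D, forall e, ~~ crossing d e} -> d \in D].

Definition polygon_edge (N : nat) (D : seq (nat * nat)) (e : nat * nat) : bool :=
  polygon_side N e || (e \in D).

(** A triangle of any kind is the triple of its sides in counter-clockwise
    order. *)
Definition triangle (A : Type) : Type := (A * A * A)%type.

Definition sides (A : Type) (t : triangle A) : seq A :=
  [:: t.1.1; t.1.2; t.2].

Definition map_triangle (A B : Type) (f : A -> B) (t : triangle A) :
    triangle B :=
  (f t.1.1, f t.1.2, f t.2).

Definition triangle_of_vertices (p : nat * nat * nat) : triangle (nat * nat) :=
  let: (i, j, l) := p in ((i, j), (j, l), (i, l)).

Definition polygon_triangles (N : nat) (D : seq (nat * nat)) :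
    seq (triangle (nat * nat)) :=
  [seq triangle_of_vertices p
     | p <- [seq (ij, l) | ij <- [seq (i, j) | i <- iota 0 N, j <- iota 0 N],
                           l <- iota 0 N]
     & (p.1.1 < p.1.2 < p.2)
       && all (polygon_edge N D) (sides (triangle_of_vertices p))].

(** ** Special triangulations *)

(** Loops [z_i] ([i < g]) and [y_l] ([l < h]) based at a marked point of [b_0]
    cut the surface into one-holed tori [H_i], annuli [A_l] and a polygon [P].
    Numbering starts from [0]: [A_l] contains the boundary component with
    [marked S (lift ord0 l)] marked points.

    The polygon [P] has vertices [0, ..., N.-1] modulo [N], with
    [N = k_0 + g + h]; the segments of [b_0] are the sides [(i, i+1)] with
    [i < k_0], followed by the sides [z] and then the sides [y].  As segments
    are named by their endpoints, the identifications between the diagonals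
    [x], [z], [y], the sides of [P] and (when [P] is a bigon) the segment of
    [b_0] hold by definition. *)
Section SpecialTriangulation.

Variable S : surface.

Definition disk_size : nat := marked S ord0 + genus S + holes S.

Definition segments (l : 'I_(holes S)) : nat := marked S (lift ord0 l).

Definition disk_boundary (e : nat * nat) : bool :=
  [exists i : 'I_(marked S ord0), e == edge disk_size i i.+1].

(** The polygon inside the annulus [A_l] has vertices [0, ..., k_l]; its sides
    are the segments [(i, i+1)] of the boundary component and the loop [x_l],
    which is the segment [(0, k_l)]. *)
Definition annulus_boundary (l : 'I_(holes S)) (e : nat * nat) : bool :=
  (e.2 == e.1.+1) && (e.2 <= segments l).

(** [torus_flip] and [annulus_flip] record the part of the cyclic orders that
    the choice of names leaves open: the direction of the simple arrow between
    [beta_i] and [eps_i], and of the double arrow between [a_l] and [c_l]. *)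
Record special_triangulation := SpecialTriangulation {
  disk_diagonals : seq (nat * nat);
  annulus_diagonals : 'I_(holes S) -> seq (nat * nat);
  torus_flip : 'I_(genus S) -> bool;
  annulus_flip : 'I_(holes S) -> bool;
  disk_diagonalsP : polygon_triangulation disk_size disk_diagonals;
  disk_x : 0 < genus S + holes S ->
    polygon_edge disk_size disk_diagonals (edge disk_size 0 (marked S ord0));
  (* the case [j = 0] is the diagonal cutting off all the [z]-sides *)
  disk_z : forall j, j < genus S ->
    polygon_edge disk_size disk_diagonals
      (edge disk_size (marked S ord0 + j) (marked S ord0 + genus S));
  disk_y : forall j, j < holes S ->
    polygon_edge disk_size disk_diagonals
      (edge disk_size (marked S ord0 + genus S + j)
                      (marked S ord0 + genus S + holes S));
  (* the triangles whose vertices are among [0, ..., k_0] are those of the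
     polygon cut off by [x], or of [P] when [g = h = 0] *)
  disk_no_inner : {in polygon_triangles disk_size disk_diagonals, forall t,
    all (fun e : nat * nat => e.2 <= marked S ord0) (sides t) ->
    has disk_boundary (sides t)};
  annulus_diagonalsP : forall l,
    polygon_triangulation (segments l).+1 (annulus_diagonals l);
  annulus_no_inner : forall l,
    {in polygon_triangles (segments l).+1 (annulus_diagonals l), forall t,
      has (annulus_boundary l) (sides t)}
}.

(** Arcs and boundary segments; [alpha], [beta], [gamma], [eps] lie in the
    tori, and [arc_a], [arc_c] in the annuli. *)
Inductive side : Type :=
  | DiskEdge of nat * nat
  | AnnulusEdge of 'I_(holes S) & nat * nat
  | alpha of 'I_(genus S)
  | beta of 'I_(genus S)
  | gamma of 'I_(genus S)
  | eps of 'I_(genus S)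
  | arc_a of 'I_(holes S)
  | arc_c of 'I_(holes S).

Definition side_code (s : side) :
    (nat * nat) + ('I_(holes S) * (nat * nat))
    + ('I_(genus S) * 'I_4) + ('I_(holes S) * bool) :=
  match s with
  | DiskEdge e => inl (inl (inl e))
  | AnnulusEdge l e => inl (inl (inr (l, e)))
  | alpha i => inl (inr (i, inord 0))
  | beta i => inl (inr (i, inord 1))
  | gamma i => inl (inr (i, inord 2))
  | eps i => inl (inr (i, inord 3))
  | arc_a l => inr (l, false)
  | arc_c l => inr (l, true)
  end.

Definition side_decode
    (c : (nat * nat) + ('I_(holes S) * (nat * nat))
         + ('I_(genus S) * 'I_4) + ('I_(holes S) * bool)) : side :=
  match c with
  | inl (inl (inl e)) => DiskEdge e
  | inl (inl (inr (l, e))) => AnnulusEdge l e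
  | inl (inr (i, j)) =>
      match val j with
      | 0 => alpha i | 1 => beta i | 2 => gamma i | _ => eps i
      end
  | inr (l, false) => arc_a l
  | inr (l, true) => arc_c l
  end.

Lemma side_codeK : cancel side_code side_decode.
Proof. by case=> //= i; rewrite inordK. Qed.

HB.instance Definition _ := Countable.copy side (can_type side_codeK).

Definition boundary_segment (s : side) : bool :=
  match s with
  | DiskEdge e => disk_boundary e
  | AnnulusEdge l e => annulus_boundary l e
  | _ => false
  end.

Definition loop_z (i : 'I_(genus S)) : side :=
  DiskEdge (edge disk_size (marked S ord0 + i) (marked S ord0 + i).+1).

Definition loop_y (l : 'I_(holes S)) : side :=
  DiskEdge (edge disk_size (marked S ord0 + genus S + l)
                           (marked S ord0 + genus S + l).+1).

Definition loop_x (l : 'I_(holes S)) : side := AnnulusEdge l (0, segments l).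

Variable T : special_triangulation.

Definition torus_triangles (i : 'I_(genus S)) : seq (triangle side) :=
  [:: (alpha i, gamma i, beta i);
      (alpha i, gamma i, eps i);
      if torus_flip T i then (eps i, beta i, loop_z i)
      else (beta i, eps i, loop_z i)].

Definition annulus_triangles (l : 'I_(holes S)) : seq (triangle side) :=
  (if annulus_flip T l
   then [:: (loop_y l, arc_c l, arc_a l); (loop_x l, arc_c l, arc_a l)]
   else [:: (loop_y l, arc_a l, arc_c l); (loop_x l, arc_a l, arc_c l)])
  ++ [seq map_triangle (AnnulusEdge l) t
        | t <- polygon_triangles (segments l).+1 (annulus_diagonals T l)].

Definition surface_triangles : seq (triangle side) :=
  [seq map_triangle DiskEdge t
     | t <- polygon_triangles disk_size (disk_diagonals T)]
  ++ flatten [seq torus_triangles i | i <- enum 'I_(genus S)]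
  ++ flatten [seq annulus_triangles l | l <- enum 'I_(holes S)].

(** The interior arcs, without repetition. *)
Definition arcs : seq side :=
  undup [seq s <- flatten (map (@sides side) surface_triangles)
        | ~~ boundary_segment s].

End SpecialTriangulation.

(** ** Quivers *)

(** A quiver without loops and 2-cycles is given by the number [q i j] of arrows
    from [i] to [j]. *)
Definition quiver (I : Type) : Type := I -> I -> nat.

(** Arrows of a triangle follow the counter-clockwise order of its sides. *)
Definition triangle_arrows (A : eqType) (t : triangle A) : quiver A :=
  fun i j => ((i, j) == (t.1.1, t.1.2)) + ((i, j) == (t.1.2, t.2))
             + ((i, j) == (t.2, t.1.1)).

(** The truncated difference implements the cancellation of opposite arrows. *)
Definition quiver_of_triangles (A : eqType) (ts : seq (triangle A)) : quiver A :=
  fun i j => (\sum_(t <- ts) triangle_arrows t i j)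
             - (\sum_(t <- ts) triangle_arrows t j i).

Definition opposite (I : Type) (q : quiver I) : quiver I := fun i j => q j i.

Definition joined_by (I : Type) (q : quiver I) (i j : I) : nat := q i j + q j i.

Definition oriented_cycle (I : Type) (q : quiver I) (i j k : I) : bool :=
  [&& 0 < q i j, 0 < q j k & 0 < q k i]
  || [&& 0 < q j i, 0 < q k j & 0 < q i k].

Section SpecialQuiver.

Variables (S : surface) (T : special_triangulation S).

Definition arrows : quiver (side S) :=
  quiver_of_triangles (surface_triangles T).

Definition vertex : Type := seq_sub (arcs T).
HB.instance Definition _ := Finite.on vertex.

Definition special_quiver : quiver vertex := fun i j => arrows (val i) (val j).

(** The vertices of the subquiver of type [A_m]. *)
Definition finite_part (s : side S) : bool :=
  match s with arc_c _ | alpha _ | gamma _ => false | _ => true end.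

Definition finite_arcs : seq (side S) := [seq s <- arcs T | finite_part s].

Definition finite_rank : nat := size finite_arcs.

End SpecialQuiver.

Arguments special_quiver {S} T i j.

(** ** Groups given by generators and relations *)

Local Open Scope group_scope.

Section Presentation.

Variables (I : choiceType) (relator : seq I -> Prop).

(** The letter [(i, b)] is the generator [i], inverted when [b] is true. *)
Definition word : Type := seq (I * bool).

Definition inv_letter (x : I * bool) : I * bool := (x.1, ~~ x.2).

Definition positive (w : seq I) : word := [seq (i, false) | i <- w].

Definition inv_word (w : word) : word := rev (map inv_letter w).

Inductive word_eq : word -> word -> Prop :=
  | word_eq_refl w : word_eq w w
  | word_eq_sym w w' : word_eq w w' -> word_eq w' w
  | word_eq_trans w' w w'' : word_eq w w' -> word_eq w' w'' -> word_eq w w''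
  | word_eq_cancel u x v : word_eq (u ++ [:: x; inv_letter x] ++ v) (u ++ v)
  | word_eq_relator u w v : relator w -> word_eq (u ++ positive w ++ v) (u ++ v).

Lemma word_eq_catl u w w' : word_eq w w' -> word_eq (u ++ w) (u ++ w').
Proof.
elim=> {w w'} [w|w w' _ IH|w' w w'' _ IH _ IH'|u' x v|u' w v rw].
- exact: word_eq_refl.
- exact: word_eq_sym.
- exact: word_eq_trans IH'.
- by have := word_eq_cancel (u ++ u') x v; rewrite -!catA.
- by have := word_eq_relator (u ++ u') v rw; rewrite -!catA.
Qed.

Lemma word_eq_catr u w w' : word_eq w w' -> word_eq (w ++ u) (w' ++ u).
Proof.
elim=> {w w'} [w|w w' _ IH|w' w w'' _ IH _ IH'|u' x v|u' w v rw].
- exact: word_eq_refl.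
- exact: word_eq_sym.
- exact: word_eq_trans IH'.
- by have := word_eq_cancel u' x (v ++ u); rewrite -!catA.
- by have := word_eq_relator u' (v ++ u) rw; rewrite -!catA.
Qed.

Lemma inv_letterK : involutive inv_letter.
Proof. by case=> i b; rewrite /inv_letter /= negbK. Qed.

Lemma inv_wordK : involutive inv_word.
Proof.
move=> w; rewrite /inv_word map_rev revK -map_comp -[RHS]map_id.
by apply: eq_map => x /=; rewrite inv_letterK.
Qed.

Lemma word_eqV w : word_eq (inv_word w ++ w) [::].
Proof.
elim: w => [|x w IH]; first exact: word_eq_refl.
rewrite /inv_word /= rev_cons cat_rcons.
have := word_eq_cancel (inv_word w) (inv_letter x) w.
by rewrite inv_letterK /= => /word_eq_trans; apply.
Qed.

Lemma word_eq_inv w w' : word_eq w w' -> word_eq (inv_word w) (inv_word w').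
Proof.
move=> e.
have e1 := word_eqV w; have e2 := word_eqV (inv_word w').
rewrite inv_wordK in e2.
apply: (@word_eq_trans (inv_word w ++ (w' ++ inv_word w'))).
  by apply: word_eq_sym; rewrite -[X in word_eq _ X]cats0; apply: word_eq_catl.
rewrite catA -[X in word_eq _ X]cat0s; apply: word_eq_catr.
apply: word_eq_trans e1; apply: word_eq_catl; exact: word_eq_sym.
Qed.

Definition word_eqb : rel word := fun w w' => `[< word_eq w w' >].

Lemma word_eqb_refl : reflexive word_eqb.
Proof. by move=> w; apply/asboolP; apply: word_eq_refl. Qed.

Lemma word_eqb_sym : symmetric word_eqb.
Proof. by move=> w w'; apply/asboolP/asboolP; apply: word_eq_sym. Qed.

Lemma word_eqb_trans : transitive word_eqb.
Proof.
move=> w' w w'' /asboolP e /asboolP e'; apply/asboolP.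
exact: word_eq_trans e'.
Qed.

Canonical word_equiv := 
  EquivRel word_eqb word_eqb_refl word_eqb_sym word_eqb_trans.

Definition presented_group : Type := {eq_quot word_equiv}%qT.
HB.instance Definition _ := Choice.on presented_group.

Definition presented_class (w : word) : presented_group :=
  (\pi_({eq_quot word_equiv}) w)%qT.
Definition presented_repr (x : presented_group) : word :=
  repr (x : {eq_quot word_equiv}%qT).

Lemma presented_reprK x : presented_class (presented_repr x) = x.
Proof. exact: reprK. Qed.

Lemma presented_classP w w' :
  presented_class w = presented_class w' <-> word_eq w w'.
Proof.
split=> [/eqquotP|e]; first by move=> /asboolP.
by apply/eqquotP; apply/asboolP.
Qed.

Lemma presented_classK w : word_eq (presented_repr (presented_class w)) w.
Proof. by apply/presented_classP; rewrite presented_reprK. Qed.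

Definition presented_mul (x y : presented_group) : presented_group :=
  presented_class (presented_repr x ++ presented_repr y).
Definition presented_inv (x : presented_group) : presented_group :=
  presented_class (inv_word (presented_repr x)).
Definition presented_one : presented_group := presented_class [::].

Lemma presented_mulE w w' :
  presented_mul (presented_class w) (presented_class w')
  = presented_class (w ++ w').
Proof.
apply/presented_classP.
apply: (@word_eq_trans (w ++ presented_repr (presented_class w'))).
  by apply: word_eq_catr; apply: presented_classK.
by apply: word_eq_catl; apply: presented_classK.
Qed.

Lemma presented_invE w :
  presented_inv (presented_class w) = presented_class (inv_word w).
Proof. by apply/presented_classP/word_eq_inv/presented_classK. Qed.

Lemma presented_mulA : associative presented_mul.
Proof.
move=> x y z; rewrite -(presented_reprK x) -(presented_reprK y).
by rewrite -(presented_reprK z) !presented_mulE catA.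
Qed.

Lemma presented_mul1 : left_id presented_one presented_mul.
Proof. by move=> x; rewrite -(presented_reprK x) presented_mulE. Qed.

Lemma presented_1mul : right_id presented_one presented_mul.
Proof. by move=> x; rewrite -(presented_reprK x) presented_mulE cats0. Qed.

Lemma presented_mulV : left_inverse presented_one presented_inv presented_mul.
Proof.
move=> x; rewrite -(presented_reprK x) presented_invE presented_mulE.
by apply/presented_classP/word_eqV.
Qed.

Lemma presented_Vmul : right_inverse presented_one presented_inv presented_mul.
Proof.
move=> x; rewrite -(presented_reprK x) presented_invE presented_mulE.
apply/presented_classP; have := word_eqV (inv_word (presented_repr x)).
by rewrite inv_wordK.
Qed.

HB.instance Definition _ := isGroup.Build presented_group presented_mulA
  presented_mul1 presented_1mul presented_mulV presented_Vmul.

Definition generator (i : I) : presented_group := presented_class [:: (i, false)].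

End Presentation.

(** ** The group of a quiver *)

Definition pow (I : Type) (n : nat) (w : seq I) : seq I := flatten (nseq n w).

(** Relations for one of the two orientations of each subquiver; [q i j = 1]
    and [q i j = 2] are a simple and a double arrow [i -> j]. *)
Inductive quiver_relator (I : eqType) (q : quiver I) : seq I -> Prop :=
  | R1 i : quiver_relator q (pow 2 [:: i])
  | R2_unjoined i j : i != j -> joined_by q i j = 0%N ->
      quiver_relator q (pow 2 [:: i; j])
  | R2_simple i j : i != j -> joined_by q i j = 1%N ->
      quiver_relator q (pow 3 [:: i; j])
  | R3_simple i1 i2 i3 : uniq [:: i1; i2; i3] ->
      q i1 i2 = 1%N -> q i2 i3 = 1%N -> q i3 i1 = 1%N ->
      quiver_relator q (pow 2 [:: i1; i2; i3; i2])
  | R3_double i1 i2 i3 : uniq [:: i1; i2; i3] ->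
      q i1 i3 = 2%N -> q i3 i2 = 1%N -> q i2 i1 = 1%N ->
      quiver_relator q (pow 3 [:: i1; i2; i3; i2])
  | R4 i1 i2 i3 i4 : uniq [:: i1; i2; i3; i4] ->
      q i1 i3 = 2%N -> q i3 i2 = 1%N -> q i2 i1 = 1%N ->
      q i3 i4 = 1%N -> q i4 i1 = 1%N -> joined_by q i2 i4 = 0%N ->
      quiver_relator q (pow 2 [:: i1; i2; i3; i4; i3; i2])
  | R5_four i1 i2 i3 i4 : uniq [:: i1; i2; i3; i4] ->
      q i1 i3 = 2%N -> q i3 i2 = 1%N -> q i2 i1 = 1%N ->
      q i3 i4 = 1%N -> q i4 i1 = 1%N -> joined_by q i2 i4 = 1%N ->
      quiver_relator q (pow 3 [:: i1; i2; i3; i4; i3; i2])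
  | R5_five i1 i2 i3 i4 i5 : uniq [:: i1; i2; i3; i4; i5] ->
      q i1 i3 = 2%N -> q i3 i2 = 1%N -> q i2 i1 = 1%N ->
      q i3 i4 = 1%N -> q i4 i1 = 1%N ->
      [\/ [/\ q i2 i4 = 1%N, q i4 i5 = 1%N & q i5 i2 = 1%N]
        | [/\ q i4 i2 = 1%N, q i2 i5 = 1%N & q i5 i4 = 1%N]] ->
      joined_by q i5 i1 = 0%N -> joined_by q i5 i3 = 0%N ->
      quiver_relator q (pow 2 [:: i1; i2; i3; i4; i5; i4; i3; i2]).

Definition quiver_group (I : choiceType) (q : quiver I) : Type :=
  presented_group (fun w => quiver_relator q w \/ quiver_relator (opposite q) w).
HB.instance Definition _ (I : choiceType) (q : quiver I) :=
  Group.on (quiver_group q).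

Definition quiver_generator (I : choiceType) (q : quiver I) (i : I) :
    quiver_group q :=
  generator _ i.

(** ** Generated subgroups and linear automorphisms *)

Section Generated.

Variables (G : groupType) (A : G -> Prop).

Inductive generated : G -> Prop :=
  | generated_base x : A x -> generated x
  | generated_one : generated 1
  | generated_mul x y : generated x -> generated y -> generated (x * y)
  | generated_inv x : generated x -> generated x^-1.

Definition generatedb : pred G := fun x => `[< generated x >].

Lemma generatedb_closed : group_closed generatedb.
Proof.
split; first by apply/asboolP/generated_one.
move=> x y /asboolP gx /asboolP gy; apply/asboolP.
by apply: generated_mul => //; apply: generated_inv.
Qed.

Definition generated_group : Type := {x : G | generatedb x}.
HB.instance Definition _ := SubChoice.on generated_group.
HB.instance Definition _ :=
  SubChoice_isSubGroup.Build G generatedb generated_group generatedb_closed.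

End Generated.

Section LinearAutomorphisms.

Variables (R : fieldType) (E : vectType R).

Definition lin_aut : Type := {f : 'End(E) | lker f == 0%VS}.
HB.instance Definition _ := SubChoice.on lin_aut.

Definition lin_aut_fun (f : lin_aut) : E -> E := val f.
Coercion lin_aut_fun : lin_aut >-> Funclass.

Lemma lin_aut_mul_subproof (f g : lin_aut) : lker (val f \o val g)%VF == 0%VS.
Proof.
apply/lker0P => x y; rewrite !lfunE /=.
by move/(lker0P (valP f))/(lker0P (valP g)).
Qed.

Lemma lin_aut_one_subproof : lker (\1%VF : 'End(E)) == 0%VS.
Proof. by apply/lker0P => x y; rewrite !lfunE. Qed.

Lemma lin_aut_inv_subproof (f : lin_aut) : lker ((val f)^-1)%VF == 0%VS.
Proof.
apply/lker0P => x y e.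
by rewrite -(lker0_lfunVK (valP f) x) -(lker0_lfunVK (valP f) y) e.
Qed.

Definition lin_aut_mul (f g : lin_aut) : lin_aut :=
  Sub (val f \o val g)%VF (lin_aut_mul_subproof f g).
Definition lin_aut_one : lin_aut := Sub \1%VF lin_aut_one_subproof.
Definition lin_aut_inv (f : lin_aut) : lin_aut :=
  Sub ((val f)^-1)%VF (lin_aut_inv_subproof f).

Lemma lin_aut_mulA : associative lin_aut_mul.
Proof. by move=> f g k; apply: val_inj; rewrite /= comp_lfunA. Qed.

Lemma lin_aut_mul1 : left_id lin_aut_one lin_aut_mul.
Proof. by move=> f; apply: val_inj; rewrite /= comp_lfun1l. Qed.

Lemma lin_aut_1mul : right_id lin_aut_one lin_aut_mul.
Proof. by move=> f; apply: val_inj; rewrite /= comp_lfun1r. Qed.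

Lemma lin_aut_mulV : left_inverse lin_aut_one lin_aut_inv lin_aut_mul.
Proof. by move=> f; apply: val_inj; rewrite /= lker0_compVf ?(valP f). Qed.

Lemma lin_aut_Vmul : right_inverse lin_aut_one lin_aut_inv lin_aut_mul.
Proof. by move=> f; apply: val_inj; rewrite /= lker0_compfV ?(valP f). Qed.

HB.instance Definition _ := isGroup.Build lin_aut lin_aut_mulA
  lin_aut_mul1 lin_aut_1mul lin_aut_mulV lin_aut_Vmul.

End LinearAutomorphisms.

(** ** The special companion basis *)

Local Open Scope ring_scope.

Section TypeA.

Variables (R : realType) (m : nat).

(** The space spanned by the root system [A_m]: vectors of [R^(m+1)] with
    coordinate sum [0]. *)
Definition typeA_space : Type :=
  subvs_of (lker (linfun (mulmxr (const_mx 1 : 'cV[R]_m.+1)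
                          : 'rV[R]_m.+1 -> 'rV[R]_1))).
HB.instance Definition _ := Vector.on typeA_space.

Definition typeA_form (x y : typeA_space) : R :=
  (vsval x *m (vsval y)^T) 0 0.

Definition typeA_root (x : typeA_space) : Prop :=
  exists i j : 'I_m.+1, i != j /\ vsval x = delta_mx 0 i - delta_mx 0 j.

End TypeA.

Section CompanionBasis.

Variables (R : realType) (S : surface) (T : special_triangulation S).

Local Notation Vplus := (typeA_space R (finite_rank T)).

(** The index set of the basis of [V_0]: one element for each hole and two for
    each handle. *)
Definition radical_index : Type := ('I_(holes S) + 'I_(genus S) * bool)%type.
HB.instance Definition _ := Finite.on radical_index.

Definition radical : Type := {ffun radical_index -> R^o}.
HB.instance Definition _ := Vector.on radical.

Definition delta (k : radical_index) : radical := [ffun j => (j == k)%:R].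

(** [V_+ + V_0 + V_0^*]. *)
Definition extended_space : Type := (Vplus * radical * 'Hom(radical, R^o))%type.
HB.instance Definition _ := Vector.on extended_space.

Definition extended_form (x y : extended_space) : R :=
  typeA_form x.1.1 y.1.1 + y.2 x.1.2 + x.2 y.1.2.

(** The values of [v] on labels that are not vertices of the subquiver of type
    [A_m] are irrelevant. *)
Record special_roots (v : side S -> Vplus) : Prop := SpecialRoots {
  roots_typeA : {in finite_arcs T, forall i, typeA_root (v i)};
  roots_basis : basis_of fullv [seq v i | i <- finite_arcs T];
  roots_arrows : {in finite_arcs T &, forall i j, i != j ->
    `|typeA_form (v i) (v j)| = (joined_by (arrows T) i j)%:R};
  roots_cycle : {in finite_arcs T & &, forall i j k,
    oriented_cycle (arrows T) i j k ->
    0 < typeA_form (v i) (v j) * typeA_form (v j) (v k) * typeA_form (v k) (v i)};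
  roots_non_cycle : {in finite_arcs T & &, forall i j k,
    uniq [:: i; j; k] -> ~~ oriented_cycle (arrows T) i j k ->
    typeA_form (v i) (v j) * typeA_form (v j) (v k) * typeA_form (v k) (v i) <= 0};
  roots_torus : forall i, typeA_form (v (beta i)) (v (eps i)) = -1
}.

Definition companion_vector (v : side S -> Vplus) (s : side S) : extended_space :=
  match s with
  | arc_c l => (v (arc_a l), delta (inl l), 0)
  | alpha i => (v (beta i) + v (eps i), delta (inr (i, false)), 0)
  | gamma i => (v (beta i) + v (eps i), delta (inr (i, true)), 0)
  | _ => (v s, 0, 0)
  end.

Definition reflection (u w : extended_space) : extended_space :=
  w - extended_form w u *: u.

Definition extended_affine_Weyl (v : side S -> Vplus) : Type :=
  generated_group (fun f : lin_aut extended_space =>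
    exists i : vertex T, f =1 reflection (companion_vector v (val i))).
HB.instance Definition _ (v : side S -> Vplus) :=
  Group.on (extended_affine_Weyl v).

Definition Weyl_action (v : side S -> Vplus) (f : extended_affine_Weyl v) :
    extended_space -> extended_space :=
  lin_aut_fun (val f).

End CompanionBasis.

(* Main.v *)
Require Import Defs.
From HB Require Import structures.
From mathcomp Require Import all_boot all_order all_algebra.
From mathcomp Require Import boolp reals.
From mathcomp Require Import ring lra.

(** The theorem says that the reflections [r_i] satisfy the relations of [G(Q)];
    surjectivity is then automatic, because [W] is generated by the [r_i].

    Apart from the squares of the generators, each relator is a power of a word
    [1 2 ... k ... 2], hence of [1] times a conjugate of [k].  Since
    [r_u r_w r_u] is the reflection in [r_u(w)] ([refl_conj]), the relation
    becomes one between two reflections in vectors [x], [y] of square length 2: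
    they commute if [<x, y> = 0], and their product has order 3 if
    [<x, y>] is 1 or -1.  So only the Gram matrix matters, and it suffices that
    [|<u_i, u_j>|] be the number of arrows between [i] and [j] for all
    [i <> j], and that [<u_i, u_j><u_j, u_k><u_k, u_i>] be positive on oriented
    3-cycles ([companion_family]).  In a cycle with two simple arrows, the sign
    condition makes the third inner product equal to the product of the other
    two, times the number of arrows ([companion_cycle_edge]); with this, every
    inner product needed in the relations is a short computation
    ([quiver_relator_refl]).

    On the subquiver of type [A_m] both conditions hold by the choice of the
    roots.  They have to be transported to the vertices [c_l], [alpha_i],
    [gamma_i] left out, whose vectors are [v(a_l)] and [v(beta_i) + v(eps_i)]
    up to the radical.  The triangles around these arcs are explicit, which
    gives all their arrows:

    - [c_l] and [a_l] are joined by a double arrow, and each is joined by one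
      arrow to those of the loops [x_l], [y_l] that are arcs; so the row of
      [c_l] in the Gram matrix has to agree with that of [a_l], as it does, the
      diagonal entry 2 of [a_l] becoming the double arrow;
    - [alpha_i] and [gamma_i] are joined by a double arrow, and only to
      [beta_i], [eps_i] besides.  Now [<v(beta_i), v(eps_i)> = -1] makes the
      sum [v(beta_i) + v(eps_i)] a root having product 1 with both summands;
      and it is orthogonal to [z_i] because the oriented 3-cycle
      [beta_i, eps_i, z_i] has positive product ([handle_form_finite]).

    A directed 3-cycle through one of these vertices contains a double arrow,
    and there positivity can be read off ([exceptional_cycle]). *)

Set Implicit Arguments.
Unset Strict Implicit.
Unset Printing Implicit Defensive.

Import Order.TTheory GRing.Theory Num.Theory.

(** * Morphisms out of a presented group *)

Section PresentedMorphism.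

Local Open Scope group_scope.

Variables (I : choiceType) (relator : seq I -> Prop) (H : groupType) (f : I -> H).

Definition eval_letter (x : I * bool) : H := if x.2 then (f x.1)^-1 else f x.1.

Definition eval_word (w : word I) : H := foldr (fun x h => eval_letter x * h) 1 w.

Lemma eval_word_cat w w' : eval_word (w ++ w') = eval_word w * eval_word w'.
Proof. by elim: w => [|x w IH] /=; rewrite ?mul1g // IH mulgA. Qed.

Lemma eval_word_eq :
    (forall w, relator w -> eval_word (positive w) = 1) ->
  forall w w', word_eq relator w w' -> eval_word w = eval_word w'.
Proof.
move=> h w w'; elim=> {w w'} [//|//|w' w w'' _ -> _ ->//|a x b|a w b rw].
  rewrite !eval_word_cat; congr (_ * _); rewrite -[RHS]mul1g; congr (_ * _).
  by rewrite /= mulg1 /eval_letter; case: x => i [] /=; rewrite ?mulgV ?mulVg.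
by rewrite !eval_word_cat h // mul1g.
Qed.

(** The universal property; the morphism evaluates any representing word. *)
Lemma presented_morphism :
    (forall w, relator w -> eval_word (positive w) = 1) ->
  exists phi : {multiplicative presented_group relator -> H},
    forall i, phi (generator relator i) = f i.
Proof.
move=> h; pose phi (x : presented_group relator) := eval_word (presented_repr x).
have phiE w : phi (presented_class relator w) = eval_word w.
  by apply/eval_word_eq/presented_classK.
have phiM : {morph phi : x y / x * y}.
  move=> x y; rewrite -(presented_reprK x) -(presented_reprK y).
  by rewrite [X in phi X]presented_mulE !phiE eval_word_cat.
pose M := isMultiplicative.Build _ _ phi phiM.
pose psi : {multiplicative presented_group relator -> H} := HB.pack phi M.
by exists psi => i; rewrite [LHS]phiE /= mulg1.
Qed.

End PresentedMorphism.

Lemma multiplicative1 (G H : groupType) (f : {multiplicative G -> H}) :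
  f 1%g = 1%g.
Proof. by apply: (mulgI (f 1%g)); rewrite -gmulfM !mulg1. Qed.

Lemma multiplicativeV (G H : groupType) (f : {multiplicative G -> H}) x :
  f (x^-1)%g = ((f x)^-1)%g.
Proof. by apply: (mulgI (f x)); rewrite -gmulfM !mulgV multiplicative1. Qed.

(** * Reflections *)

Section Reflections.

Local Open Scope ring_scope.

Variables (R : realFieldType) (E : lmodType R) (B : E -> E -> R).

Definition symmetric_bilinear : Prop :=
  [/\ forall x y, B x y = B y x,
      forall x y z, B (x + y) z = B x z + B y z
    & forall a x y, B (a *: x) y = a * B x y].

Hypothesis BP : symmetric_bilinear.

Definition refl (u w : E) : E := w - B w u *: u.

Lemma form_sym x y : B x y = B y x.
Proof. by case: BP. Qed.

Lemma formBZl a x y z : B (x - a *: y) z = B x z - a * B y z.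
Proof. by case: BP => _ hD hZ; rewrite hD -scaleNr hZ mulNr. Qed.

Lemma formBZr a x y z : B x (y - a *: z) = B x y - a * B x z.
Proof. by rewrite form_sym formBZl !(form_sym x). Qed.

Lemma reflK u : B u u = 2 -> involutive (refl u).
Proof.
move=> uu x; rewrite /refl formBZl uu -addrA -opprD -scalerDl.
suff -> : B x u + (B x u - B x u * 2) = 0 by rewrite scale0r subr0.
by ring.
Qed.

Lemma form_refl u x y : B u u = 2 -> B (refl u x) (refl u y) = B x y.
Proof.
move=> uu; rewrite /refl formBZl !formBZr uu (form_sym u y).
by ring.
Qed.

Lemma refl_linear u a x y : refl u (a *: x + y) = a *: refl u x + refl u y.
Proof.
case: BP => _ hD hZ; rewrite /refl hD hZ scalerDl -scalerA scalerBr opprD.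
by rewrite addrACA.
Qed.

Lemma refl_subZ u a x y : refl u (x - a *: y) = refl u x - a *: refl u y.
Proof.
by rewrite -!scaleNr ![x + _]addrC refl_linear [RHS]addrC.
Qed.

(** [refl u] is an isometry, so it carries the reflection in [w] to the one in
    [refl u w]. *)
Lemma refl_conj u w x :
  B u u = 2 -> refl u (refl w (refl u x)) = refl (refl u w) x.
Proof.
move=> uu; have reflE y : refl w y = y - B y w *: w by [].
by rewrite reflE refl_subZ -(form_refl _ w uu) reflK.
Qed.

Lemma reflZ s u x : s ^+ 2 = 1 -> refl (s *: u) x = refl u x.
Proof.
case: BP => _ _ hZ s2; rewrite /refl form_sym hZ (form_sym u) scalerA.
by rewrite mulrAC -expr2 s2 mul1r.
Qed.

Lemma refl_order2 u w x : B u u = 2 -> B w w = 2 -> B u w = 0 ->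
  refl u (refl w (refl u (refl w x))) = x.
Proof.
move=> uu ww uw; rewrite (refl_conj _ _ uu).
suff -> : refl u w = w by rewrite reflK.
by rewrite /refl form_sym uw scale0r subr0.
Qed.

(** With [s = B u w], the last three factors are the reflection in
    [refl w u = u - s w = - s (w - s u)], and the first three are the reflection
    in [refl u w = w - s u]. *)
Lemma refl_order3 u w x : B u u = 2 -> B w w = 2 -> `|B u w| = 1 ->
  refl u (refl w (refl u (refl w (refl u (refl w x))))) = x.
Proof.
move=> uu ww uw.
have s2 : B u w ^+ 2 = 1 by rewrite -real_normK ?num_real // uw expr1n.
rewrite (refl_conj _ _ uu) (refl_conj _ _ ww).
have -> : refl w u = (- B u w) *: refl u w.
  rewrite /refl (form_sym w u) scalerBr scalerA mulNr -expr2 s2 scaleNr scaleN1r.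
  by rewrite opprK addrC.
by rewrite reflZ ?sqrrN // reflK // form_refl.
Qed.

End Reflections.

(** * Companion families satisfy the relations *)

Section CompanionFamily.

Local Open Scope ring_scope.

Variables (R : realFieldType) (E : lmodType R) (B : E -> E -> R).
Hypothesis BP : symmetric_bilinear B.

Variables (I : eqType) (q : quiver I) (u : I -> E).

(** What the relations see of a companion basis: its Gram matrix.  By
    [companion_no_2cycle], the number [q i j], if positive, counts all the arrows
    between [i] and [j]. *)
Record companion_family : Prop := CompanionFamily {
  companion_norm : forall i, B (u i) (u i) = 2;
  companion_no_2cycle : forall i j, (q i j == 0%N) || (q j i == 0%N);
  companion_arrows : forall i j, i != j ->
    `|B (u i) (u j)| = (joined_by q i j)%:R;
  companion_cycle : forall i j k, oriented_cycle q i j k ->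
    0 < B (u i) (u j) * B (u j) (u k) * B (u k) (u i)
}.

Hypothesis uP : companion_family.

Local Notation a i j := (B (u i) (u j)).

Lemma joined_by_arrows n i j : q i j = n.+1 -> joined_by q i j = n.+1.
Proof.
move=> qij; have := companion_no_2cycle uP i j.
by rewrite /joined_by qij /= => /eqP ->; rewrite addn0.
Qed.

Lemma arrows_neq n i j : q i j = n.+1 -> i != j.
Proof.
move=> qij; apply: contraTneq (companion_no_2cycle uP i j) => e.
by move: qij; rewrite e => ->.
Qed.

Lemma companion_value n i j :
  q i j = n.+1 -> a i j = n.+1%:R \/ a i j = - n.+1%:R.
Proof.
move=> qij.
have /eqP := companion_arrows uP (arrows_neq qij).
by rewrite (joined_by_arrows qij) eqr_norml => /andP[/orP[] /eqP -> _];
  [left | right].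
Qed.

Lemma companion_unjoined i j : i != j -> joined_by q i j = 0%N -> a i j = 0.
Proof.
by move=> ij qij; apply: normr0_eq0; rewrite (companion_arrows uP) // qij.
Qed.

Lemma companion_sqr i j : q i j = 1%N -> a i j ^+ 2 = 1.
Proof. by case/companion_value => ->; rewrite ?sqrrN expr1n. Qed.

(** The sign condition of an oriented cycle with two simple arrows, solved for
    the third entry. *)
Lemma companion_cycle_edge n i j k :
    q i j = n.+1 -> q j k = 1%N -> q k i = 1%N ->
  a i j = n.+1%:R * (a i k * a k j).
Proof.
move=> ij jk ki; have : 0 < a i j * a j k * a k i.
  by apply: (companion_cycle uP); rewrite /oriented_cycle ij jk ki.
rewrite (form_sym BP (u i) (u k)) (form_sym BP (u k) (u j)).
have n0 : 0 < n.+1%:R :> R by rewrite ltr0Sn.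
move: (n.+1%:R) n0 (companion_value ij) => N N0 vij.
by case: vij => ->; case: (companion_value jk) => ->;
  case: (companion_value ki) => -> => c; lra.
Qed.

(** The cycle turns [a i1 i3] into [2 (a i1 i2 * a i2 i3)]; one of these two
    copies cancels against the correction by [u i2] of the vector [u i3]. *)
Lemma double_arrow_form i1 i2 i3 x :
    q i1 i3 = 2%N -> q i3 i2 = 1%N -> q i2 i1 = 1%N ->
  B (u i1) (refl B (u i2) (refl B (u i3) x))
  = B (u i1) x - B x (u i2) * a i1 i2 - B x (u i3) * (a i1 i2 * a i2 i3).
Proof.
move=> q13 q32 q21; rewrite /refl !(formBZr, formBZl) //.
by rewrite (companion_cycle_edge q13 q32 q21) (form_sym BP (u i3) (u i2)); ring.
Qed.

(** Two cycles on the same double arrow give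
    [a i1 i2 * a i2 i3 = a i1 i4 * a i4 i3], so that only the contribution of
    the edge between [i2] and [i4] survives. *)
Lemma double_arrow_form4 i1 i2 i3 i4 :
    q i1 i3 = 2%N -> q i3 i2 = 1%N -> q i2 i1 = 1%N ->
    q i3 i4 = 1%N -> q i4 i1 = 1%N ->
  B (u i1) (refl B (u i2) (refl B (u i3) (u i4))) = - (a i4 i2 * a i1 i2).
Proof.
move=> q13 q32 q21 q34 q41; rewrite double_arrow_form //.
have h2 := companion_cycle_edge q13 q32 q21.
have h4 := companion_cycle_edge q13 q34 q41.
have -> : a i1 i2 * a i2 i3 = a i1 i4 * a i4 i3 by lra.
suff : a i1 i4 = a i4 i3 * (a i1 i4 * a i4 i3) by lra.
by rewrite mulrCA -expr2 (form_sym BP (u i4)) companion_sqr // mulr1.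
Qed.

(** Conjugations reduce every relator to the second or third power of a product
    of two reflections.  The inner product of their roots has to be 0 for the
    second power and 1 or -1 for the third; on the relators with cycles,
    [companion_cycle_edge] reduces it to this. *)
Lemma quiver_relator_refl w x :
  quiver_relator q w -> foldr (fun i => refl B (u i)) x w = x.
Proof.
have uu := companion_norm uP; have sym := form_sym BP.
case=> /=.
- by move=> i; rewrite reflK.
- by move=> i j ij /(companion_unjoined ij); apply: refl_order2.
- move=> i j ij qij; apply: refl_order3 => //.
  by rewrite (companion_arrows uP) // qij.
- move=> i1 i2 i3 _ q12 q23 q31.
  rewrite !(refl_conj BP (u i3) _ (uu i2)).
  apply: refl_order2; rewrite ?form_refl // /refl formBZr //.
  rewrite (sym (u i1) (u i3)) (companion_cycle_edge q31 q12 q23).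
  by rewrite (sym (u i2) (u i1)); ring.
- move=> i1 i2 i3 _ q13 q32 q21.
  rewrite !(refl_conj BP (u i3) _ (uu i2)).
  apply: refl_order3; rewrite ?form_refl // /refl formBZr //.
  rewrite (companion_cycle_edge q13 q32 q21) (sym (u i3) (u i2)).
  rewrite [X in `|X|](_ : _ = a i1 i2 * a i2 i3); last by ring.
  rewrite (sym (u i1) (u i2)) (sym (u i2) (u i3)) normrM.
  by rewrite !(companion_arrows uP) ?(joined_by_arrows q32)
    ?(joined_by_arrows q21) ?(arrows_neq q32) ?(arrows_neq q21) ?mulr1.
- move=> i1 i2 i3 i4 u4 q13 q32 q21 q34 q41 q24.
  rewrite !(refl_conj BP (u i4) _ (uu i3)).
  rewrite !(refl_conj BP (refl B (u i3) (u i4)) _ (uu i2)).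
  apply: refl_order2; rewrite ?form_refl ?form_refl //.
  rewrite double_arrow_form4 // (sym (u i4)) companion_unjoined ?mul0r ?oppr0 //.
  by move: u4; rewrite /= !inE !negb_or => /and4P[_ /andP[]].
- move=> i1 i2 i3 i4 u4 q13 q32 q21 q34 q41 q24.
  rewrite !(refl_conj BP (u i4) _ (uu i3)).
  rewrite !(refl_conj BP (refl B (u i3) (u i4)) _ (uu i2)).
  apply: refl_order3; rewrite ?form_refl ?form_refl //.
  rewrite double_arrow_form4 // normrN normrM (sym (u i4)) (sym (u i1)).
  rewrite !(companion_arrows uP) ?(joined_by_arrows q21) ?(arrows_neq q21) //.
    by rewrite q24 mulr1.
  by move: u4; rewrite /= !inE !negb_or => /and4P[_ /andP[]].
- move=> i1 i2 i3 i4 i5 u5 q13 q32 q21 q34 q41 q245 q51 q53.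
  rewrite !(refl_conj BP (u i5) _ (uu i4)).
  rewrite !(refl_conj BP (refl B (u i4) (u i5)) _ (uu i3)).
  rewrite !(refl_conj BP (refl B (u i3) _) _ (uu i2)).
  apply: refl_order2; rewrite ?form_refl ?form_refl //.
  have reflB i y c z :
      refl B (u i) (y - c *: z) = refl B (u i) y - c *: refl B (u i) z.
    exact: refl_subZ.
  have -> : refl B (u i4) (u i5) = u i5 - a i5 i4 *: u i4 by [].
  rewrite (reflB i3) (reflB i2) formBZr //.
  rewrite (double_arrow_form4 q13 q32 q21 q34 q41).
  rewrite (double_arrow_form _ q13 q32 q21).
  have n51 : i5 != i1.
    by apply: contraTneq u5 => ->; rewrite /= !inE eqxx !(orbT, andbF).
  have n53 : i5 != i3.
    by apply: contraTneq u5 => ->; rewrite /= !inE eqxx !(orbT, andbF).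
  rewrite (sym (u i1) (u i5)) (companion_unjoined n51 q51).
  rewrite (companion_unjoined n53 q53).
  (* both orientations of the cycle on [i2], [i4], [i5] give this, by symmetry
     of the form *)
  have -> : a i5 i2 = a i5 i4 * a i4 i2.
    case: q245 => [[q24 q45 q52]|[q42 q25 q54]].
      by rewrite (companion_cycle_edge q52 q24 q45); ring.
    rewrite (sym (u i5) (u i2)) (companion_cycle_edge q25 q54 q42) (sym (u i2)).
    by rewrite (sym (u i4) (u i5)); ring.
  by ring.
Qed.

End CompanionFamily.

Lemma companion_family_opposite (R : realFieldType) (E : lmodType R)
    (B : E -> E -> R) (I : eqType) (q : quiver I) (u : I -> E) :
  companion_family B q u -> companion_family B (opposite q) u.
Proof.
case=> norm2 no2 arr cyc; split=> //.
- by move=> i j; rewrite orbC no2.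
- by move=> i j ij; rewrite arr // /joined_by addnC.
- by move=> i j k; rewrite /oriented_cycle orbC; apply: cyc.
Qed.

(** * Arrows at the arcs inside the handles and annuli *)

Ltac decide_side_eqs :=
  repeat match goal with
  | |- context [?a == ?a] => rewrite (eqxx a)
  | |- context [?a == ?b] =>
      assert_fails (is_var a); have -> : (a == b) = false by apply/eqP
  end.

Section ArrowCounts.

Variables (S : surface) (T : special_triangulation S).

Definition arrow_count (ts : seq (triangle (side S))) (s t : side S) : nat :=
  \sum_(x <- ts) triangle_arrows x s t.

Lemma triangle_arrows0 (x : triangle (side S)) s t :
  (s \notin sides x) || (t \notin sides x) -> triangle_arrows x s t = 0.
Proof.
case: x => [[x y] z]; rewrite /triangle_arrows /sides !inE /= !xpair_eqE.
by case/orP; rewrite !negb_or => /and3P[/negPf -> /negPf -> /negPf ->];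
  rewrite ?andbF.
Qed.

Lemma arrow_count0 ts s t :
    {in ts, forall x, (s \notin sides x) || (t \notin sides x)} ->
  arrow_count ts s t = 0.
Proof.
move=> h; rewrite /arrow_count big1_seq // => x /andP[_ xts].
by apply: triangle_arrows0; apply: h.
Qed.

Lemma arrow_count_flatten (I : finType) (f : I -> seq (triangle (side S)))
    i s t :
    (forall j, j != i ->
      {in f j, forall x, (s \notin sides x) || (t \notin sides x)}) ->
  arrow_count (flatten [seq f j | j <- enum I]) s t = arrow_count (f i) s t.
Proof.
move=> h; rewrite /arrow_count big_flatten big_map big_enum (bigD1 i) //=.
by rewrite [X in _ + X]big1 ?addn0 // => j ji; apply: arrow_count0; apply: h.
Qed.

Definition handle_arc (i : 'I_(genus S)) (s : side S) : bool :=
  s \in [:: alpha i; beta i; gamma i; eps i].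

Definition hole_arc (l : 'I_(holes S)) (s : side S) : bool :=
  s \in [:: arc_a l; arc_c l].

Lemma handle_arcP i s :
  reflect [\/ s = alpha i, s = beta i, s = gamma i | s = eps i] (handle_arc i s).
Proof.
rewrite /handle_arc !inE.
by apply: (iffP or4P) => -[] h;
  [constructor 1 | constructor 2 | constructor 3 | constructor 4
  | constructor 1 | constructor 2 | constructor 3 | constructor 4]; apply/eqP.
Qed.

(** Locality: the arcs inside a handle are sides of its three triangles only. *)
Lemma count_handle i s t : handle_arc i s ->
  arrow_count (surface_triangles T) s t
    = arrow_count (torus_triangles T i) s t /\
  arrow_count (surface_triangles T) t s
    = arrow_count (torus_triangles T i) t s.
Proof.
move=> hs.
have hd (e : triangle (nat * nat)) :
    s \notin sides (map_triangle (@DiskEdge S) e).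
  by case: e => -[a b] c; case/handle_arcP: hs => ->.
have ht j : j != i -> {in torus_triangles T j, forall x, s \notin sides x}.
  move=> ji x; rewrite /torus_triangles !inE.
  case: ifP => _; case/or3P=> /eqP ->; case/handle_arcP: hs => ->;
    apply/negP; rewrite ?inE => /or3P[] /eqP // -[] e; by rewrite e eqxx in ji.
have ha l : {in annulus_triangles T l, forall x, s \notin sides x}.
  move=> x; rewrite /annulus_triangles mem_cat => /orP[].
    by case: ifP => _; rewrite !inE => /orP[] /eqP ->;
      case/handle_arcP: hs => ->.
  by case/mapP=> -[[a b] c] _ ->; case/handle_arcP: hs => ->.
have aux s' t' : (s' == s) || (t' == s) ->
  arrow_count (surface_triangles T) s' t'
  = arrow_count (torus_triangles T i) s' t'.
  move=> st.
  have st0 x : s \notin sides x -> (s' \notin sides x) || (t' \notin sides x).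
    by case/orP: st => /eqP -> ->; rewrite ?orbT.
  rewrite {1}/arrow_count /surface_triangles !big_cat /= -!/(arrow_count _ _ _).
  rewrite (@arrow_count0 (map _ _)); last first.
    by move=> x /mapP[e _ ->]; apply: st0; apply: hd.
  rewrite (arrow_count_flatten (i := i)); last first.
    by move=> j ji x xj; apply/st0/(ht j).
  rewrite add0n [X in _ + X]arrow_count0 ?addn0 //.
  by move=> x /flattenP[_ /mapP[l _ ->]] xl; apply/st0/(ha l).
by split; apply: aux; rewrite eqxx ?orbT.
Qed.

Lemma hole_arcP l s : reflect (s = arc_a l \/ s = arc_c l) (hole_arc l s).
Proof.
by rewrite /hole_arc !inE; apply: (iffP orP) => -[] h;
  [left | right | left | right]; apply/eqP.
Qed.

(** The two triangles of the annulus with sides [arc_a l] and [arc_c l]. *)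
Definition annulus_core (l : 'I_(holes S)) : seq (triangle (side S)) :=
  if annulus_flip T l
  then [:: (loop_y l, arc_c l, arc_a l); (loop_x l, arc_c l, arc_a l)]
  else [:: (loop_y l, arc_a l, arc_c l); (loop_x l, arc_a l, arc_c l)].

Lemma count_hole l s t : hole_arc l s ->
  arrow_count (surface_triangles T) s t = arrow_count (annulus_core l) s t /\
  arrow_count (surface_triangles T) t s = arrow_count (annulus_core l) t s.
Proof.
move=> hs.
have hd (e : triangle (nat * nat)) :
    s \notin sides (map_triangle (@DiskEdge S) e).
  by case: e => -[a b] c; case/hole_arcP: hs => ->.
have ht i : {in torus_triangles T i, forall x, s \notin sides x}.
  move=> x; rewrite /torus_triangles !inE.
  by case: ifP => _; case/or3P=> /eqP ->; case/hole_arcP: hs => ->.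
have ha j : j != l -> {in annulus_triangles T j, forall x, s \notin sides x}.
  move=> jl x; rewrite /annulus_triangles mem_cat => /orP[].
    case: ifP => _; rewrite !inE => /orP[] /eqP ->; case/hole_arcP: hs => ->;
    apply/negP; rewrite ?inE => /or3P[] /eqP // -[] e; by rewrite e eqxx in jl.
  case/mapP=> -[[a b] c] _ ->.
  by case/hole_arcP: hs => ->.
have hl x : x \in [seq map_triangle (AnnulusEdge l) e
    | e <- polygon_triangles (segments l).+1 (annulus_diagonals T l)] ->
    s \notin sides x.
  by case/mapP=> -[[a b] c] _ ->; case/hole_arcP: hs => ->.
have aux s' t' : (s' == s) || (t' == s) ->
  arrow_count (surface_triangles T) s' t' = arrow_count (annulus_core l) s' t'.
  move=> st.
  have st0 x : s \notin sides x -> (s' \notin sides x) || (t' \notin sides x).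
    by case/orP: st => /eqP -> ->; rewrite ?orbT.
  rewrite {1}/arrow_count /surface_triangles !big_cat /= -!/(arrow_count _ _ _).
  rewrite (@arrow_count0 (map _ _)); last first.
    by move=> x /mapP[e _ ->]; apply: st0; apply: hd.
  rewrite add0n (arrow_count_flatten (i := l)); last first.
    by move=> j jl x xj; apply/st0/(ha j).
  rewrite arrow_count0 ?add0n; last first.
    by move=> x /flattenP[_ /mapP[j _ ->]] xj; apply/st0/(ht j).
  rewrite {1}/arrow_count /annulus_triangles big_cat /= -!/(arrow_count _ _ _).
  by rewrite [X in _ + X]arrow_count0 ?addn0 // => x xl; apply/st0/hl.
by split; apply: aux; rewrite eqxx ?orbT.
Qed.

End ArrowCounts.

Section ArrowTable.

Variables (S : surface) (T : special_triangulation S).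

(** The count becomes a truncated difference of sums of equality tests on [t];
    [split_on] then evaluates it at the possible neighbours. *)
Ltac expand_arrows out inn :=
  rewrite /arrows /quiver_of_triangles -!/(arrow_count _ _ _) out inn;
  rewrite /torus_triangles /annulus_core; case: ifP => _;
  rewrite /arrow_count !big_cons !big_nil /triangle_arrows !xpair_eqE /=;
  decide_side_eqs; rewrite ?(andbF, andbT).

Ltac split_on t x :=
  case: (eqVneq t x) => [?|_]; try subst t; decide_side_eqs => //.

Lemma arrows_alpha i t :
  arrows T (alpha i) t = (t == gamma i) * 2 /\
  arrows T t (alpha i) = (t == beta i) + (t == eps i).
Proof.
have hi : handle_arc i (alpha i) by rewrite /handle_arc !inE eqxx.
have [out inn] := count_handle T t hi.
expand_arrows out inn.
all: split_on t (gamma i); split_on t (beta i); split_on t (eps i).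
Qed.

Lemma arrows_gamma i t :
  arrows T (gamma i) t = (t == beta i) + (t == eps i) /\
  arrows T t (gamma i) = (t == alpha i) * 2.
Proof.
have hi : handle_arc i (gamma i) by rewrite /handle_arc !inE eqxx ?orbT.
have [out inn] := count_handle T t hi.
expand_arrows out inn.
all: split_on t (alpha i); split_on t (beta i); split_on t (eps i).
Qed.

Lemma arrows_beta i t :
  arrows T (beta i) t
    = (t == alpha i) + (t == if torus_flip T i then loop_z i else eps i) /\
  arrows T t (beta i)
    = (t == gamma i) + (t == if torus_flip T i then eps i else loop_z i).
Proof.
have hi : handle_arc i (beta i) by rewrite /handle_arc !inE eqxx ?orbT.
have [out inn] := count_handle T t hi.
expand_arrows out inn.
all: split_on t (alpha i); split_on t (gamma i); split_on t (eps i);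
  split_on t (loop_z i).
Qed.

Lemma arrows_eps i t :
  arrows T (eps i) t
    = (t == alpha i) + (t == if torus_flip T i then beta i else loop_z i) /\
  arrows T t (eps i)
    = (t == gamma i) + (t == if torus_flip T i then loop_z i else beta i).
Proof.
have hi : handle_arc i (eps i) by rewrite /handle_arc !inE eqxx ?orbT.
have [out inn] := count_handle T t hi.
expand_arrows out inn.
all: split_on t (alpha i); split_on t (gamma i); split_on t (beta i);
  split_on t (loop_z i).
Qed.

(** The two ends of the double arrow of an annulus; which of [arc_a], [arc_c] is
    the source depends on the orientation recorded by [annulus_flip]. *)
Definition double_tail l : side S :=
  if annulus_flip T l then arc_c l else arc_a l.
Definition double_head l : side S :=
  if annulus_flip T l then arc_a l else arc_c l.

Lemma arrows_tail l t :
  arrows T (double_tail l) t = (t == double_head l) * 2 /\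
  arrows T t (double_tail l) = (t == loop_x l) + (t == loop_y l).
Proof.
have hl : hole_arc l (double_tail l).
  by rewrite /double_tail; case: ifP => _; rewrite /hole_arc !inE eqxx ?orbT.
have [out inn] := count_hole T t hl.
move: out inn; rewrite /double_tail /double_head => out inn.
expand_arrows out inn.
all: split_on t (arc_a l); split_on t (arc_c l); split_on t (loop_y l);
  split_on t (loop_x l).
Qed.

Lemma arrows_head l t :
  arrows T (double_head l) t = (t == loop_x l) + (t == loop_y l) /\
  arrows T t (double_head l) = (t == double_tail l) * 2.
Proof.
have hl : hole_arc l (double_head l).
  by rewrite /double_head; case: ifP => _; rewrite /hole_arc !inE eqxx ?orbT.
have [out inn] := count_hole T t hl.
move: out inn; rewrite /double_tail /double_head => out inn.
expand_arrows out inn.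
all: split_on t (arc_a l); split_on t (arc_c l); split_on t (loop_y l);
  split_on t (loop_x l).
Qed.

(** Forgetting orientations makes the two arcs interchangeable, whatever
    [annulus_flip] is. *)
Lemma joined_hole l t :
  joined_by (arrows T) (arc_a l) t
    = ((t == loop_x l) + (t == loop_y l) + (t == arc_c l) * 2)%N /\
  joined_by (arrows T) (arc_c l) t
    = ((t == loop_x l) + (t == loop_y l) + (t == arc_a l) * 2)%N.
Proof.
have [o n] := arrows_tail l t; have [o' n'] := arrows_head l t.
move: o n o' n'; rewrite /joined_by /double_tail /double_head.
by case: (annulus_flip T l) => -> -> -> ->; split=> //; rewrite addnC.
Qed.

Lemma no_2cycle s t : (arrows T s t == 0%N) || (arrows T t s == 0%N).
Proof.
rewrite /arrows /quiver_of_triangles !subn_eq0.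
exact: leq_total.
Qed.

Lemma joined_byC s t : joined_by (arrows T) s t = joined_by (arrows T) t s.
Proof. exact: addnC. Qed.

Lemma arc_side x s : x \in surface_triangles T -> s \in sides x ->
  ~~ boundary_segment s -> s \in arcs T.
Proof.
move=> xT sx bs; rewrite mem_undup mem_filter bs.
by apply/flattenP; exists (sides x) => //; apply: map_f.
Qed.

Lemma torus_triangle_in i x :
  x \in torus_triangles T i -> x \in surface_triangles T.
Proof.
move=> xi; rewrite !mem_cat; apply/orP; right; apply/orP; left.
apply/flattenP; exists (torus_triangles T i) => //.
by apply: map_f; rewrite mem_enum.
Qed.

Lemma finite_arcsE s : (s \in finite_arcs T) = finite_part s && (s \in arcs T).
Proof. by rewrite mem_filter. Qed.

Lemma beta_finite i : beta i \in finite_arcs T.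
Proof.
rewrite finite_arcsE /=; apply: (@arc_side (alpha i, gamma i, beta i)) => //.
  by apply: (@torus_triangle_in i); rewrite inE eqxx.
by rewrite !inE eqxx !orbT.
Qed.

Lemma eps_finite i : eps i \in finite_arcs T.
Proof.
rewrite finite_arcsE /=; apply: (@arc_side (alpha i, gamma i, eps i)) => //.
  by apply: (@torus_triangle_in i); rewrite !inE eqxx orbT.
by rewrite !inE eqxx !orbT.
Qed.

Lemma arc_a_finite l : arc_a l \in finite_arcs T.
Proof.
rewrite finite_arcsE /=.
apply: (@arc_side (if annulus_flip T l then (loop_y l, arc_c l, arc_a l)
  else (loop_y l, arc_a l, arc_c l))) => //; last first.
  by case: ifP => _; rewrite !inE eqxx !orbT.
rewrite !mem_cat; apply/orP; right; apply/orP; right.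
apply/flattenP; exists (annulus_triangles T l).
  by apply: map_f; rewrite mem_enum.
by rewrite mem_cat; case: ifP; rewrite inE eqxx.
Qed.

End ArrowTable.

(** * The Gram matrix of the special companion vectors *)

Section Gram.

Local Open Scope ring_scope.

Variables (R : realType) (S : surface) (T : special_triangulation S).

Lemma typeA_formC m (x y : typeA_space R m) : typeA_form x y = typeA_form y x.
Proof.
rewrite /typeA_form -[in LHS](trmxK (vsval x *m _)) trmx_mul trmxK.
by rewrite [LHS]mxE.
Qed.

Lemma typeA_form_linearl m a (x y z : typeA_space R m) :
  typeA_form (a *: x + y) z = a * typeA_form x z + typeA_form y z.
Proof. by rewrite /typeA_form linearP /= mulmxDl -scalemxAl !mxE. Qed.

Lemma typeA_formDl m (x y z : typeA_space R m) :
  typeA_form (x + y) z = typeA_form x z + typeA_form y z.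
Proof. by rewrite -[x]scale1r typeA_form_linearl scale1r mul1r. Qed.

Lemma typeA_formDr m (x y z : typeA_space R m) :
  typeA_form x (y + z) = typeA_form x y + typeA_form x z.
Proof. by rewrite typeA_formC typeA_formDl !(typeA_formC x). Qed.

Lemma typeA_form_root m (x : typeA_space R m) :
  typeA_root x -> typeA_form x x = 2.
Proof.
case=> i [j [ij e]]; rewrite /typeA_form e linearB /= mulmxBl !mulmxBr.
rewrite !trmx_delta !mul_delta_mx_cond !eqxx (negPf ij) eq_sym (negPf ij).
by rewrite !mxE !eqxx /=; ring.
Qed.

Lemma extended_form_bilinear : symmetric_bilinear (@extended_form R S T).
Proof.
split.
- by move=> x y; rewrite /extended_form typeA_formC -!addrA [X in _ + X]addrC.
- move=> x y z; rewrite /extended_form /= typeA_formDl linearD /= lfunE /=; ring.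
- move=> a x y; rewrite /extended_form /= -[a *: x.1.1]addr0.
  rewrite typeA_form_linearl linearZ /= lfunE /=.
  have -> : typeA_form 0 y.1.1 = 0 by rewrite /typeA_form linear0 mul0mx mxE.
  by rewrite /GRing.scale /=; ring.
Qed.

Variable v : side S -> typeA_space R (finite_rank T).
Hypothesis hv : special_roots v.

Local Notation form := (@typeA_form R (finite_rank T)).
(** The component in [V_+]; the rest lies in the radical [V_0]. *)
Local Notation proj s := (companion_vector v s).1.1.

Lemma companion_form s t :
  extended_form (companion_vector v s) (companion_vector v t)
  = form (proj s) (proj t).
Proof.
have dual0 x : (companion_vector v x).2 = 0 by case: x.
by rewrite /extended_form !dual0 !lfunE /= !addr0.
Qed.

Lemma form_root s : s \in finite_arcs T -> form (v s) (v s) = 2.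
Proof. by move=> sF; apply/typeA_form_root/(roots_typeA hv). Qed.

Lemma form_unjoined s t :
    s \in finite_arcs T -> t \in finite_arcs T -> s != t ->
  joined_by (arrows T) s t = 0%N -> form (v s) (v t) = 0.
Proof.
by move=> sF tF st j; apply: normr0_eq0; rewrite (roots_arrows hv) // j.
Qed.

Lemma form_simple s t :
    s \in finite_arcs T -> t \in finite_arcs T -> s != t ->
  joined_by (arrows T) s t = 1%N ->
  form (v s) (v t) = 1 \/ form (v s) (v t) = - 1.
Proof.
move=> sF tF st j; have /eqP := roots_arrows hv sF tF st.
by rewrite j eqr_norml => /andP[/orP[] /eqP -> _]; [left|right].
Qed.

(** Among the vertices of the subquiver of type [A_m], [beta i] and [eps i]
    are joined only to each other and to [loop_z i], and the contributions of
    the two roots at [loop_z i] cancel. *)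
Lemma handle_form_finite i t : t \in finite_arcs T ->
  form (v (beta i) + v (eps i)) (v t) = (t == beta i)%:R + (t == eps i)%:R.
Proof.
move=> tF; have [bF eF] := (beta_finite T i, eps_finite T i).
rewrite typeA_formDl.
have be := roots_torus hv i.
case: (eqVneq t (beta i)) => [->|tb].
  rewrite (typeA_formC (v (eps i))) be form_root //; decide_side_eqs.
  by rewrite /= addr0; lra.
case: (eqVneq t (eps i)) => [->|te].
  by rewrite be form_root //; decide_side_eqs; rewrite /= add0r; lra.
have tfin : finite_part t by move: tF; rewrite finite_arcsE => /andP[].
have ta : (t == alpha i) = false by apply/eqP => e; rewrite e in tfin.
have tg : (t == gamma i) = false by apply/eqP => e; rewrite e in tfin.
have jb : joined_by (arrows T) (beta i) t = (t == loop_z i).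
  have [o n] := arrows_beta T i t; rewrite /joined_by o n ta tg.
  by case: (torus_flip T i); rewrite (negPf te) ?addn0.
have je : joined_by (arrows T) (eps i) t = (t == loop_z i).
  have [o n] := arrows_eps T i t; rewrite /joined_by o n ta tg.
  by case: (torus_flip T i); rewrite (negPf tb) ?addn0.
rewrite eq_sym in tb; rewrite eq_sym in te.
case: (eqVneq t (loop_z i)) => tz; last first.
  by rewrite !form_unjoined ?jb ?je ?(negPf tz) //= !addr0.
(* [t = loop_z i] closes an oriented cycle with [beta i] and [eps i], so its
   products with their roots have opposite signs *)
have cyc : oriented_cycle (arrows T) (beta i) (eps i) t.
  have [ob nb] := arrows_beta T i t; have [oe ne] := arrows_eps T i t.
  have [obe nbe] := arrows_beta T i (eps i).
  rewrite /oriented_cycle ob nb oe ne obe nbe tz.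
  by case: (torus_flip T i); rewrite ?eqxx ?orbT //=; decide_side_eqs.
have := roots_cycle hv bF eF tF cyc; rewrite be (typeA_formC (v t)).
have := form_simple bF tF tb; rewrite jb tz eqxx => /(_ erefl).
have := form_simple eF tF te; rewrite je tz eqxx => /(_ erefl).
by case=> ->; case=> -> c; rewrite /= (_ : false%:R = 0) //; lra.
Qed.

(** The row of the Gram matrix common to [alpha i] and [gamma i]. *)
Lemma handle_form i t : t \in arcs T ->
  form (v (beta i) + v (eps i)) (proj t)
  = (t == beta i)%:R + (t == eps i)%:R
    + (t == alpha i)%:R * 2 + (t == gamma i)%:R * 2.
Proof.
have fin t' : finite_part t' -> t' \in arcs T ->
  form (v (beta i) + v (eps i)) (v t')
  = (t' == beta i)%:R + (t' == eps i)%:R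
    + (t' == alpha i)%:R * 2 + (t' == gamma i)%:R * 2.
  move=> fp t'T; rewrite handle_form_finite ?finite_arcsE ?fp //.
  have -> : (t' == alpha i) = false by apply/eqP => e; rewrite e in fp.
  have -> : (t' == gamma i) = false by apply/eqP => e; rewrite e in fp.
  by rewrite mul0r !addr0.
have inner j : form (v (beta i) + v (eps i)) (v (beta j) + v (eps j))
    = (j == i)%:R * 2.
  rewrite typeA_formDr !handle_form_finite ?beta_finite ?eps_finite //.
  case: (eqVneq j i) => [->|ji]; decide_side_eqs.
    by rewrite /= addr0 add0r; lra.
  have -> : (beta j == beta i) = false by apply/eqP => -[] e; rewrite e eqxx in ji.
  have -> : (eps j == eps i) = false by apply/eqP => -[] e; rewrite e eqxx in ji.
  by rewrite /= mul0r !addr0.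
case: t => [e|l e|j|j|j|j|l|l] tT /=; try exact: fin.
- rewrite inner; decide_side_eqs.
  have -> : (alpha j == alpha i) = (j == i) by apply/eqP/eqP => [[]|->].
  by rewrite /= mul0r !add0r addr0.
- rewrite inner; decide_side_eqs.
  have -> : (gamma j == gamma i) = (j == i) by apply/eqP/eqP => [[]|->].
  by rewrite /= mul0r !add0r.
- rewrite handle_form_finite ?arc_a_finite //; decide_side_eqs.
  by rewrite /= mul0r !addr0.
Qed.

Lemma gram_alpha i t : t \in arcs T -> t != alpha i ->
  `|form (proj (alpha i)) (proj t)| = (joined_by (arrows T) (alpha i) t)%:R.
Proof.
move=> tT ta; rewrite handle_form // (negPf ta).
have [o n] := arrows_alpha T i t; rewrite /joined_by o n mul0r addr0.
by rewrite ger0_norm ?addr_ge0 ?mulr_ge0 ?ler0n // !natrD natrM addrC.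
Qed.

Lemma gram_gamma i t : t \in arcs T -> t != gamma i ->
  `|form (proj (gamma i)) (proj t)| = (joined_by (arrows T) (gamma i) t)%:R.
Proof.
move=> tT tg; rewrite handle_form // (negPf tg).
have [o n] := arrows_gamma T i t; rewrite /joined_by o n mul0r addr0.
by rewrite ger0_norm ?addr_ge0 ?mulr_ge0 ?ler0n // !natrD natrM.
Qed.

(** The vector of [arc_c l] differs from that of [arc_a l] by an element of the
    radical, so the two arcs have the same row; their diagonal entry 2 is the
    double arrow between them. *)
Lemma gram_hole l t : t \in arcs T -> t != arc_c l ->
  (if t is arc_c _ then true else finite_part t) ->
  `|form (proj (arc_c l)) (proj t)| = (joined_by (arrows T) (arc_c l) t)%:R.
Proof.
move=> tT tc tk.
have [ja jc] := joined_hole T l t; rewrite jc.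
case: (eqVneq t (arc_a l)) => [->|ta].
  rewrite /= form_root ?arc_a_finite //; decide_side_eqs.
  by rewrite ger0_norm.
rewrite (negPf tc) in ja; rewrite -ja.
have fin : finite_part t ->
    `|form (v (arc_a l)) (v t)| = (joined_by (arrows T) (arc_a l) t)%:R.
  move=> tf; apply: (roots_arrows hv); rewrite ?arc_a_finite ?finite_arcsE ?tf //.
  by rewrite eq_sym.
case: t tT tc tk ja jc ta fin
    => [e|l' e|j|j|j|j|l'|l'] //= tT tc _ ja jc ta fin; try exact: fin.
rewrite ja; decide_side_eqs.
have ll : l != l' by apply: contraNneq tc => ->.
rewrite (roots_arrows hv) ?arc_a_finite //; last first.
  by apply: contraNneq ll => -[->].
by rewrite (joined_hole T l _).1; decide_side_eqs.
Qed.

Lemma proj_finite s : finite_part s -> proj s = v s.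
Proof. by case: s. Qed.

Lemma gram_exceptional s t : s \in arcs T -> t \in arcs T -> s != t ->
  ~~ finite_part s ->
  `|form (proj s) (proj t)| = (joined_by (arrows T) s t)%:R.
Proof.
move=> sT tT st; rewrite eq_sym in st.
case: s sT st => // [i|i|l] sT st _; first exact: gram_alpha.
  exact: gram_gamma.
case tk: (if t is arc_c _ then true else finite_part t); first exact: gram_hole.
rewrite typeA_formC joined_byC; rewrite eq_sym in st.
by case: t tT st tk => // j tT st _; [apply: gram_alpha|apply: gram_gamma].
Qed.

Lemma gram_arrows s t : s \in arcs T -> t \in arcs T -> s != t ->
  `|form (proj s) (proj t)| = (joined_by (arrows T) s t)%:R.
Proof.
move=> sT tT st.
case: (boolP (finite_part s)) => [sf|]; last exact: gram_exceptional.
case: (boolP (finite_part t)) => [tf|tx].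
  rewrite !proj_finite //.
  by apply: (roots_arrows hv); rewrite ?finite_arcsE ?sf ?tf.
by rewrite typeA_formC joined_byC; apply: gram_exceptional => //; rewrite eq_sym.
Qed.

Lemma handle_norm i :
  form (v (beta i) + v (eps i)) (v (beta i) + v (eps i)) = 2.
Proof.
have [bF eF] := (beta_finite T i, eps_finite T i).
rewrite typeA_formDr !handle_form_finite //; decide_side_eqs.
by rewrite addr0 add0r.
Qed.

(** A directed cycle through [alpha i] or [gamma i] consists of these two and of
    [beta i] or [eps i]; one through [arc_c l] contains [arc_a l]. *)
Lemma exceptional_cycle s t r :
    s \in arcs T -> t \in arcs T -> r \in arcs T ->
    ~~ finite_part s ->
  (0 < arrows T s t)%N -> (0 < arrows T t r)%N -> (0 < arrows T r s)%N ->
  0 < form (proj s) (proj t) * form (proj t) (proj r) * form (proj r) (proj s).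
Proof.
have b0 : (nat_of_bool false)%:R = 0 :> R by [].
have b1 : (nat_of_bool true)%:R = 1 :> R by [].
move=> sT tT rT; case: s sT => // [i|i|l] sT _.
- have [-> _] := arrows_alpha T i t; have [_ ->] := arrows_alpha T i r.
  case: (eqVneq t (gamma i)) tT => // -> tT _ _ rs.
  rewrite [form (proj r) _]typeA_formC !(handle_form i) //; decide_side_eqs.
  move: rs; case: (eqVneq r (beta i)) => [->|_]; decide_side_eqs.
    by rewrite ?b0 ?b1; lra.
  case: (eqVneq r (eps i)) => // -> _; decide_side_eqs.
  by rewrite ?b0 ?b1; lra.
- have [-> _] := arrows_gamma T i t; have [_ ->] := arrows_gamma T i r.
  move=> ts _; case: (eqVneq r (alpha i)) rT => // -> rT _.
  rewrite [form (proj t) _]typeA_formC.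
  rewrite [form (proj (alpha i)) (proj (gamma i))](handle_form i) //.
  rewrite !(handle_form i) //; decide_side_eqs.
  move: ts; case: (eqVneq t (beta i)) => [->|_]; decide_side_eqs.
    by rewrite ?b0 ?b1; lra.
  case: (eqVneq t (eps i)) => // -> _; decide_side_eqs.
  by rewrite ?b0 ?b1; lra.
(* [arc_a l] is one of the other two vertices; as it has the row of [arc_c l],
   the product is twice a square *)
- have aF := arc_a_finite T l.
  have aT : arc_a l \in arcs T by move: aF; rewrite finite_arcsE.
  have aa := form_root aF.
  have sqr_gt0 x : x \in arcs T -> x != arc_a l ->
      (0 < joined_by (arrows T) (arc_a l) x)%N ->
      0 < form (v (arc_a l)) (proj x) * form (v (arc_a l)) (proj x).
    move=> xT xa; rewrite -expr2 -real_normK ?num_real // -(ltr0n R).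
    rewrite -gram_arrows 1?eq_sym //.
    by move=> h; apply: exprn_gt0.
  have neq x y : (0 < arrows T x y)%N -> x != y.
    by apply: contraTneq => ->; have := no_2cycle T y y; rewrite orbb lt0n negbK.
  have [o n] := arrows_head T l t; have [o' n'] := arrows_tail T l t.
  have [O N] := arrows_head T l r; have [O' N'] := arrows_tail T l r.
  move: o n o' n' O N O' N'; rewrite /double_tail /double_head.
  case: (annulus_flip T l) => _ _ o' _ _ N _ _ st tr rs.
    move: st; rewrite o'; case: (eqVneq t (arc_a l)) tT tr => // -> tT tr _.
    rewrite [form (proj r) _]typeA_formC /= aa -mulrA mulr_gt0 //.
    by apply: sqr_gt0; rewrite // 1?eq_sym ?neq // /joined_by addn_gt0 tr.
  move: rs; rewrite N; case: (eqVneq r (arc_a l)) rT tr => // -> rT tr _.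
  rewrite [form (proj t) _]typeA_formC /= aa mulr_gt0 //.
  by apply: sqr_gt0; rewrite // ?neq // joined_byC /joined_by addn_gt0 tr.
Qed.

Lemma directed_cycle_gt0 s t r :
    s \in arcs T -> t \in arcs T -> r \in arcs T ->
  (0 < arrows T s t)%N -> (0 < arrows T t r)%N -> (0 < arrows T r s)%N ->
  0 < form (proj s) (proj t) * form (proj t) (proj r) * form (proj r) (proj s).
Proof.
move=> sT tT rT st tr rs.
case: (boolP (finite_part s)) => [sf|sx]; last exact: exceptional_cycle.
case: (boolP (finite_part t)) => [tf|tx]; last first.
  by rewrite -mulrA mulrC; apply: exceptional_cycle.
case: (boolP (finite_part r)) => [rf|rx]; last first.
  by rewrite mulrC mulrA; apply: exceptional_cycle.
rewrite !proj_finite //.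
apply: (roots_cycle hv); rewrite ?finite_arcsE ?sf ?tf ?rf //.
by rewrite /oriented_cycle st tr rs.
Qed.

Lemma special_companion_family :
  companion_family (@extended_form R S T) (special_quiver T)
    (fun i : vertex T => companion_vector v (val i)).
Proof.
have arcP (i : vertex T) : val i \in arcs T := valP i.
split.
- move=> i; rewrite companion_form.
  case: (boolP (finite_part (val i))) => [fi|].
    by rewrite !proj_finite // form_root // finite_arcsE fi arcP.
  have iT := arcP i; case: (val i) iT => // [j|j|l] iT _ /=.
  + exact: handle_norm.
  + exact: handle_norm.
  + exact/form_root/arc_a_finite.
- by move=> i j; apply: no_2cycle.
- by move=> i j ij; rewrite companion_form gram_arrows.
- move=> i j k; rewrite !companion_form => /orP[] /and3P[ij jk ki].
    exact: directed_cycle_gt0.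
  have := directed_cycle_gt0 (arcP i) (arcP k) (arcP j) ki jk ij.
  rewrite (typeA_formC (proj (val i)) (proj (val j))).
  rewrite (typeA_formC (proj (val j)) (proj (val k))).
  by rewrite (typeA_formC (proj (val k)) (proj (val i))) mulrC mulrA mulrAC.
Qed.

End Gram.

(** * The homomorphism onto the extended affine Weyl group *)

Section LinearReflections.

Local Open Scope ring_scope.

Variables (R : realFieldType) (E : vectType R) (B : E -> E -> R).
Hypothesis BP : symmetric_bilinear B.

Lemma lin_aut_ext (f g : lin_aut E) : f =1 g -> f = g.
Proof. by move=> fg; apply: val_inj; apply/lfunP. Qed.

Lemma lin_aut_mulE (f g : lin_aut E) x : lin_aut_fun (f * g)%g x = f (g x).
Proof. exact: comp_lfunE. Qed.

Lemma lin_aut_1E x : lin_aut_fun (1%g : lin_aut E) x = x.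
Proof. exact: id_lfunE. Qed.

Lemma refl_lin_aut c : B c c = 2 -> exists f : lin_aut E, f =1 refl B c.
Proof.
move=> cc.
have lin : linear (refl B c) by move=> a x y; apply: refl_linear.
pose L := GRing.isLinear.Build _ _ _ _ (refl B c) lin.
pose r : {linear E -> E} := HB.pack (refl B c) L.
have rE x : linfun r x = refl B c x by rewrite lfunE.
have kr : lker (linfun r) == 0%VS.
  by apply/lker0P => x y; rewrite !rE; apply: (inv_inj (reflK BP cc)).
by exists (Sub (linfun r) kr).
Qed.

End LinearReflections.

Section WeylGroup.

Local Open Scope ring_scope.

Variables (R : realType) (S : surface) (T : special_triangulation S).
Variable v : side S -> typeA_space R (finite_rank T).
Hypothesis hv : special_roots v.

Local Notation W := (extended_affine_Weyl v).

Lemma Weyl_ext (f g : W) : Weyl_action f =1 Weyl_action g -> f = g.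
Proof. by move=> fg; apply: val_inj; apply: lin_aut_ext. Qed.

Lemma Weyl_action_mul (f g : W) x :
  Weyl_action (f * g)%g x = Weyl_action f (Weyl_action g x).
Proof. exact: lin_aut_mulE. Qed.

Lemma Weyl_action_1 x : Weyl_action (1%g : W) x = x.
Proof. exact: lin_aut_1E. Qed.

Lemma Weyl_reflection (i : vertex T) :
  exists f : W, Weyl_action f =1 reflection (companion_vector v (val i)).
Proof.
have norm2 := companion_norm (special_companion_family hv) i.
have [f fP] := refl_lin_aut (extended_form_bilinear R T) norm2.
have gf : generatedb (fun f : lin_aut (extended_space R T) =>
    exists i : vertex T, f =1 reflection (companion_vector v (val i))) f.
  by apply/asboolP/generated_base; exists i.
by exists (Sub f gf).
Qed.

End WeylGroup.

Theorem theorem5p1 (R : realType) (S : surface) (T : special_triangulation S)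
    (v : side S -> typeA_space R (finite_rank T)) (hv : special_roots v) :
  exists phi : {multiplicative quiver_group (special_quiver T)
                               -> extended_affine_Weyl v},
    (forall i : vertex T,
        Weyl_action (phi (quiver_generator (special_quiver T) i))
        =1 reflection (companion_vector v (val i)))
    /\ (forall w : extended_affine_Weyl v, exists g, phi g = w).
Proof.
have [r rE] := choice (Weyl_reflection hv).
have family := special_companion_family hv.
have action_word w x :
    Weyl_action (eval_word r (positive w)) x
    = foldr (fun i => refl (@extended_form R S T) (companion_vector v (val i)))
        x w.
  elim: w => [|i w IH] /=; first exact: Weyl_action_1.
  by rewrite Weyl_action_mul IH /eval_letter rE.
have relP w : quiver_relator (special_quiver T) w \/
    quiver_relator (opposite (special_quiver T)) w ->
    eval_word r (positive w) = 1%g.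
  move=> relw; apply: Weyl_ext => x; rewrite action_word Weyl_action_1.
  have bilin := extended_form_bilinear R T.
  case: relw; first exact: (quiver_relator_refl bilin family).
  exact: (quiver_relator_refl bilin (companion_family_opposite family)).
have [phi phiE] := presented_morphism relP.
exists phi; split=> [i|w]; first by rewrite /quiver_generator phiE; apply: rE.
have surj f : generated (fun f : lin_aut (extended_space R T) =>
    exists i : vertex T, f =1 reflection (companion_vector v (val i))) f ->
    exists g, val (phi g) = f.
  elim=> {f} [f [i fi]||f g _ [a <-] _ [b <-]|f _ [a <-]].
  - exists (quiver_generator _ i); rewrite /quiver_generator phiE.
    by apply: lin_aut_ext => x; rewrite fi; apply: rE.
  - by exists 1%g; rewrite multiplicative1.
  - by exists (a * b)%g; rewrite gmulfM.
  - by exists (a^-1)%g; rewrite multiplicativeV.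
have /asboolP/surj[g gE] := valP w.
by exists g; apply: val_inj.
Qed.
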